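(* Let $0<a<b$ be real numbers, let $s\in(0,1)$, and let $q>1$ and $p$ satisfy $\frac1p+\frac1q=1$. Then $$\left|\frac{L_{1-s}^{1-s}(a,b)}{1-s}-\frac{sG^2(a,b)L_{-1-s}^{-1-s}(a,b)+A^{1-s}(a,b)}{2(1-s)}\right|$$ $$\le \frac{L_p(a,b)}{\left(2^{2q+s}(s+1)\right)^{1/q}}\left\{\left(b^{-sq}+\left(2^{s+1}-1\right)a^{-sq}\right)^{1/q}+\left(a^{-sq}+\left(2^{s+1}-1\right)b^{-sq}\right)^{1/q}\right\}.$$
   Context: For $0<u<v$: $A(u,v)=\frac{u+v}{2}$ (arithmetic mean), $G(u,v)=\sqrt{uv}$ (geometric mean), and for real $r\neq -1,0$, $L_r(u,v)=\left(\frac{v^{r+1}-u^{r+1}}{(r+1)(v-u)}\right)^{1/r}$ (generalized logarithmic mean). Exponents on means denote powers of their values: $A^r(u,v)=(A(u,v))^r$, $G^2(u,v)=(G(u,v))^2=uv$, and $L_r^r(u,v)=(L_r(u,v))^r=\frac{v^{r+1}-u^{r+1}}{(r+1)(v-u)}$. *)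

(* Defs.v *)
From Stdlib Require Import Reals.
Open Scope R_scope.

(* Means of two reals 0 < u < v.  Real powers are [Rpower x y = exp (y * ln x)],
   the usual x^y for x > 0. *)

Definition A (u v : R) : R := (u + v) / 2.

Definition G (u v : R) : R := sqrt (u * v).

(* Meaningful for 0 < u < v and r different from -1 and 0: the base of the
   outer power is then positive. *)
Definition L (r u v : R) : R :=
  Rpower ((Rpower v (r + 1) - Rpower u (r + 1)) / ((r + 1) * (v - u))) (1 / r).

(* Main.v *)
Require Import Defs.
From Stdlib Require Import Reals.
From Stdlib Require Import Lra.
From Coquelicot Require Import Coquelicot.
Open Scope R_scope.

(** Take f(x) = x^(1-s)/(1-s), so that f'(x) = x^(-s).  The quantity inside the
    absolute value is 1/4 of the sum of two integrals over t in [0,1], one for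
    each half of [a,b]: if u is the endpoint of the half, m the midpoint of
    [a,b] and v the opposite endpoint, the integrand is the affine weight
    (1-t) v + t u times f' at the point (1-t) u + t m ([mean_difference_split]).
    The two halves are exchanged by swapping u and v, so one estimate
    ([half_average_le]) serves both; and everything is positive, so the absolute
    value is harmless.

    On one half, Hölder's inequality separates the weight from f'.  The p-th
    power of the weight integrates to L_p^p exactly, because the weight runs
    affinely over the whole interval [a,b].  The remaining integral, that of
    x^(-sq), is controlled by the convexity of x^(-sq), which gives the bound
    (1 - t/2) u^(-sq) + (t/2) v^(-sq); relaxing the first coefficient to
    (1 - t/2)^s produces the constant (2^(s+1) - 1) / (2^s (s+1)).  Hölder's
    inequality is itself Young's inequality, integrated. *)

(** * Convexity of real powers *)

Lemma Rpower_pos (x r : R) : 0 < Rpower x r.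
Proof. apply exp_pos. Qed.

Lemma Rpower_div (x y r : R) :
  0 < x -> 0 < y -> Rpower (x / y) r = Rpower x r / Rpower y r.
Proof.
intros hx hy. unfold Rpower. rewrite ln_div by assumption.
replace (r * (ln x - ln y)) with (r * ln x + - (r * ln y)) by ring.
rewrite exp_plus, exp_Ropp. reflexivity.
Qed.

(** The graph of [exp] lies above its tangent at the weighted mean of [x] and
    [y]; averaging the tangent inequalities at [x] and at [y] cancels the linear
    terms. *)
Lemma exp_convex (l m x y : R) :
  0 <= l -> 0 <= m -> l + m = 1 ->
  exp (l * x + m * y) <= l * exp x + m * exp y.
Proof.
intros hl hm hlm.
set (z := l * x + m * y).
assert (tangent : forall w, exp z * (1 + (w - z)) <= exp w).
{ intros w. replace w with (z + (w - z)) at 2 by ring.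
  rewrite exp_plus. apply Rmult_le_compat_l.
  - apply Rlt_le, exp_pos.
  - apply exp_ineq1_le. }
apply Rle_trans
  with (l * (exp z * (1 + (x - z))) + m * (exp z * (1 + (y - z)))).
- right.
  replace (l * (exp z * (1 + (x - z))) + m * (exp z * (1 + (y - z))))
    with (exp z * ((l + m) * (1 - z) + (l * x + m * y))) by ring.
  rewrite hlm. fold z. ring.
- apply Rplus_le_compat; apply Rmult_le_compat_l; auto.
Qed.

Lemma young (p q x y : R) :
  0 < p -> 0 < q -> 1 / p + 1 / q = 1 -> 0 < x -> 0 < y ->
  x * y <= 1 / p * Rpower x p + 1 / q * Rpower y q.
Proof.
intros hp hq hpq hx hy.
replace (x * y) with (exp (1 / p * (p * ln x) + 1 / q * (q * ln y))).
- apply exp_convex; try exact hpq;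
    apply Rlt_le, Rdiv_lt_0_compat; lra.
- replace (1 / p * (p * ln x) + 1 / q * (q * ln y)) with (ln x + ln y)
    by (field; lra).
  rewrite exp_plus, !exp_ln by assumption. reflexivity.
Qed.

(** By the weighted arithmetic-geometric inequality, the weighted mean is at
    least exp of the weighted mean of the logarithms; a negative power reverses
    this, and convexity of [exp] applies once more. *)
Lemma Rpower_neg_convex (r l m x y : R) :
  0 <= r -> 0 <= l -> 0 <= m -> l + m = 1 -> 0 < x -> 0 < y ->
  Rpower (l * x + m * y) (- r) <= l * Rpower x (- r) + m * Rpower y (- r).
Proof.
intros hr hl hm hlm hx hy.
set (g := exp (l * ln x + m * ln y)).
assert (hg : g <= l * x + m * y).
{ pose proof (exp_convex l m (ln x) (ln y) hl hm hlm) as h.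
  rewrite !exp_ln in h by assumption. exact h. }
assert (hg0 : 0 < g) by apply exp_pos.
apply Rle_trans with (Rpower g (- r)).
- rewrite !Rpower_Ropp. apply Rinv_le_contravar.
  + apply Rpower_pos.
  + apply Rle_Rpower_l; lra.
- unfold Rpower, g. rewrite ln_exp.
  replace (- r * (l * ln x + m * ln y))
    with (l * (- r * ln x) + m * (- r * ln y)) by ring.
  apply exp_convex; assumption.
Qed.

Lemma le_Rpower_of_le_one (s x : R) :
  s <= 1 -> 0 < x <= 1 -> x <= Rpower x s.
Proof.
intros hs [hx hx1].
assert (hln : ln x <= 0) by (rewrite <- ln_1; apply ln_le; assumption).
rewrite <- (exp_ln x hx) at 1. unfold Rpower.
assert (h : ln x <= s * ln x) by nra.
destruct h as [h | h].
- apply Rlt_le, exp_increasing, h.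
- rewrite <- h. apply Rle_refl.
Qed.

(** * Hölder's inequality *)

(** Normalising [f] by [M] and [g] by [N] makes the integrated Young inequality
    homogeneous, and it then reads 1/p + 1/q = 1.  Upper bounds on the two
    integrals are enough, so the q-norm need not be known exactly. *)
Lemma holder (p q x y M N I F K : R) (f g : R -> R) :
  0 < p -> 0 < q -> 1 / p + 1 / q = 1 -> x <= y -> 0 < M -> 0 < N ->
  (forall t, x < t < y -> 0 < f t) ->
  (forall t, x < t < y -> 0 < g t) ->
  is_RInt (fun t => f t * g t) x y I ->
  is_RInt (fun t => Rpower (f t) p) x y F ->
  is_RInt (fun t => Rpower (g t) q) x y K ->
  F <= Rpower M p -> K <= Rpower N q ->
  I <= M * N.
Proof.
intros hp hq hpq hxy hM hN hf hg hI hF hK hFM hKN.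
set (cF := M * N * (1 / p) / Rpower M p).
set (cK := M * N * (1 / q) / Rpower N q).
assert (hMp := Rpower_pos M p). assert (hNq := Rpower_pos N q).
assert (hMN : 0 < M * N) by (apply Rmult_lt_0_compat; assumption).
assert (hcF : 0 < cF).
{ unfold cF. repeat apply Rdiv_lt_0_compat || apply Rmult_lt_0_compat; lra. }
assert (hcK : 0 < cK).
{ unfold cK. repeat apply Rdiv_lt_0_compat || apply Rmult_lt_0_compat; lra. }
apply Rle_trans with (cF * F + cK * K).
- apply (is_RInt_le (fun t => f t * g t)
           (fun t => cF * Rpower (f t) p + cK * Rpower (g t) q) x y); auto.
  + apply (is_RInt_plus (V := R_NormedModule));
      apply (is_RInt_scal (V := R_NormedModule)); assumption.
  + intros t ht. specialize (hf t ht). specialize (hg t ht).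
    pose proof (young p q (f t / M) (g t / N) hp hq hpq
                  (Rdiv_lt_0_compat _ _ hf hM) (Rdiv_lt_0_compat _ _ hg hN)) as h.
    rewrite !Rpower_div in h by assumption.
    apply (Rmult_le_compat_l (M * N)) in h; [|lra].
    replace (f t * g t) with (M * N * (f t / M * (g t / N)))
      by (field; lra).
    eapply Rle_trans; [exact h|]. right. unfold cF, cK. field.
    repeat split; lra.
- apply Rle_trans with (cF * Rpower M p + cK * Rpower N q).
  + apply Rplus_le_compat; apply Rmult_le_compat_l; lra.
  + right. unfold cF, cK. transitivity (M * N * (1 / p + 1 / q)).
    * field. repeat split; lra.
    * rewrite hpq. ring.
Qed.

(** * Averages of powers over an interval *)

(** The average of x^r between [c] and [d], in closed form; [L r c d] is its
    power of exponent 1/r. *)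
Definition power_average (r c d : R) : R :=
  (Rpower d (r + 1) - Rpower c (r + 1)) / ((r + 1) * (d - c)).

Lemma power_average_sym (r c d : R) :
  r + 1 <> 0 -> c <> d -> power_average r c d = power_average r d c.
Proof.
intros hr hcd. unfold power_average. field. repeat split; lra.
Qed.

Lemma L_sym (r u v : R) : r + 1 <> 0 -> u <> v -> L r u v = L r v u.
Proof.
intros hr huv. unfold L. f_equal. apply power_average_sym; assumption.
Qed.

Lemma affine_pos (c d t : R) :
  0 < c -> 0 < d -> 0 <= t <= 1 -> 0 < (1 - t) * c + t * d.
Proof. intros hc hd ht. destruct (Rle_lt_dec t (1 / 2)); nra. Qed.

Lemma is_derive_Rpower_affine (r c d t : R) :
  0 < (1 - t) * c + t * d ->
  is_derive (fun t => Rpower ((1 - t) * c + t * d) r) t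
    ((d - c) * (r * Rpower ((1 - t) * c + t * d) (r - 1))).
Proof.
intros h.
apply (is_derive_comp (V := R_NormedModule) (fun x => Rpower x r)
         (fun t => (1 - t) * c + t * d)).
- apply is_derive_Reals, derivable_pt_lim_power, h.
- auto_derive; [exact I | ring].
Qed.

Lemma is_RInt_Rpower_affine (r c d : R) :
  0 < c -> 0 < d -> c <> d -> r + 1 <> 0 ->
  is_RInt (fun t => Rpower ((1 - t) * c + t * d) r) 0 1 (power_average r c d).
Proof.
intros hc hd hcd hr.
assert (hI : is_RInt
  (fun t => Rpower ((1 - t) * c + t * d) r) 0 1
  (minus (/ ((r + 1) * (d - c)) * Rpower ((1 - 1) * c + 1 * d) (r + 1))
         (/ ((r + 1) * (d - c)) * Rpower ((1 - 0) * c + 0 * d) (r + 1)))).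
{ apply (is_RInt_derive (V := R_CompleteNormedModule)
    (fun t => / ((r + 1) * (d - c)) * Rpower ((1 - t) * c + t * d) (r + 1)));
    intros t ht; rewrite Rmin_left, Rmax_right in ht by lra;
    assert (hpos := affine_pos c d t hc hd ht).
  - replace (Rpower ((1 - t) * c + t * d) r)
      with (/ ((r + 1) * (d - c)) *
            ((d - c) * ((r + 1) * Rpower ((1 - t) * c + t * d) (r + 1 - 1)))).
    + apply (is_derive_scal (fun t => Rpower ((1 - t) * c + t * d) (r + 1))).
      apply is_derive_Rpower_affine, hpos.
    + replace (r + 1 - 1) with r by ring. field. split; lra.
  - apply (ex_derive_continuous (V := R_NormedModule)).
    eexists. apply is_derive_Rpower_affine, hpos. }
replace (power_average r c d) with
  (minus (/ ((r + 1) * (d - c)) * Rpower ((1 - 1) * c + 1 * d) (r + 1))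
         (/ ((r + 1) * (d - c)) * Rpower ((1 - 0) * c + 0 * d) (r + 1))).
- exact hI.
- replace ((1 - 1) * c + 1 * d) with d by ring.
  replace ((1 - 0) * c + 0 * d) with c by ring.
  unfold power_average, minus, plus, opp; simpl. field. split; lra.
Qed.

Lemma continuous_Rpower_affine (r c d t : R) :
  0 < c -> 0 < d -> 0 <= t <= 1 ->
  continuous (fun t => Rpower ((1 - t) * c + t * d) r) t.
Proof.
intros hc hd ht. apply (ex_derive_continuous (V := R_NormedModule)).
eexists. apply is_derive_Rpower_affine, affine_pos; assumption.
Qed.

Lemma power_average_pos (r c d : R) :
  0 < c -> 0 < d -> c <> d -> r + 1 <> 0 -> 0 < power_average r c d.
Proof.
intros hc hd hcd hr.
rewrite <- (is_RInt_unique _ _ _ _ (is_RInt_Rpower_affine r c d hc hd hcd hr)).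
apply RInt_gt_0; [lra | intros; apply Rpower_pos |].
intros t ht. apply continuous_Rpower_affine; assumption.
Qed.

Lemma Rpower_L (r u v : R) :
  0 < u -> 0 < v -> u <> v -> r <> 0 -> r + 1 <> 0 ->
  Rpower (L r u v) r = power_average r u v.
Proof.
intros hu hv huv hr hr1. unfold L. fold (power_average r u v).
rewrite Rpower_mult. replace (1 / r * r) with 1 by (field; exact hr).
apply Rpower_1, power_average_pos; assumption.
Qed.

(** * The estimate on one half of the interval *)

(** The average of (v + 2 u - 2 x) x^(-s) as [x] runs over the half of the
    interval that goes from [u] to the midpoint. *)
Definition half_average (s u v : R) : R :=
  (v + 2 * u) * power_average (- s) u (A u v)
  - 2 * power_average (1 - s) u (A u v).

(** At the point (1-t) u + t m the weight v + 2 u - 2 x equals (1-t) v + t u. *)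
Lemma is_RInt_half_average (s u v : R) :
  0 < s -> s < 1 -> 0 < u -> 0 < v -> u <> v ->
  is_RInt (fun t => ((1 - t) * v + t * u)
                    * Rpower ((1 - t) * u + t * A u v) (- s))
    0 1 (half_average s u v).
Proof.
intros hs0 hs1 hu hv huv.
assert (hm : 0 < A u v) by (unfold A; lra).
assert (hum : u <> A u v) by (unfold A; lra).
apply (is_RInt_ext (V := R_NormedModule)
  (fun t => minus
     (scal (v + 2 * u) (Rpower ((1 - t) * u + t * A u v) (- s)))
     (scal 2 (Rpower ((1 - t) * u + t * A u v) (1 - s))))).
- intros t ht. rewrite Rmin_left, Rmax_right in ht by lra.
  replace (1 - s) with (1 + - s) by ring.
  rewrite Rpower_plus, Rpower_1 by (apply affine_pos; lra).
  unfold minus, plus, opp, scal; simpl; unfold mult; simpl.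
  replace ((1 - t) * v + t * u)
    with (v + 2 * u - 2 * ((1 - t) * u + t * A u v)) by (unfold A; field).
  ring.
- apply (is_RInt_minus (V := R_NormedModule));
    apply (is_RInt_scal (V := R_NormedModule));
    apply is_RInt_Rpower_affine; lra.
Qed.

Lemma half_average_nonneg (s u v : R) :
  0 < s -> s < 1 -> 0 < u -> 0 < v -> u <> v -> 0 <= half_average s u v.
Proof.
intros hs0 hs1 hu hv huv.
assert (hI := is_RInt_half_average s u v hs0 hs1 hu hv huv).
rewrite <- (is_RInt_unique _ _ _ _ hI).
apply RInt_ge_0; [lra | eexists; exact hI |].
intros t ht. apply Rlt_le, Rmult_lt_0_compat; [|apply Rpower_pos].
apply affine_pos; lra.
Qed.

Lemma endpoint_sum_pos (s r u v : R) :
  0 < s -> 0 < Rpower v r + (Rpower 2 (s + 1) - 1) * Rpower u r.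
Proof.
intros hs.
assert (h : Rpower 2 0 < Rpower 2 (s + 1)) by (apply Rpower_lt; lra).
rewrite Rpower_O in h by lra.
apply Rplus_lt_0_compat; [apply Rpower_pos|].
apply Rmult_lt_0_compat; [lra | apply Rpower_pos].
Qed.

(** Convexity gives the weights 1 - t/2 and t/2 to the values at [u] and [v].
    The first is enlarged to (1 - t/2)^s and integrated; the second has integral
    1/4, which is at most 1 / (2^s (s+1)) since both factors are at most 2. *)
Lemma half_power_average_le (s r u v K : R) :
  0 < s -> s < 1 -> 0 <= r -> 0 < u -> 0 < v ->
  is_RInt (fun t => Rpower ((1 - t) * u + t * A u v) (- r)) 0 1 K ->
  K <= (Rpower v (- r) + (Rpower 2 (s + 1) - 1) * Rpower u (- r))
       / (Rpower 2 s * (s + 1)).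
Proof.
intros hs0 hs1 hr hu hv hK.
set (U := Rpower u (- r)). set (V := Rpower v (- r)).
assert (hU : 0 < U) by apply Rpower_pos.
assert (hV : 0 < V) by apply Rpower_pos.
assert (h2s : 0 < Rpower 2 s) by apply Rpower_pos.
assert (h2s2 : Rpower 2 s < 2).
{ rewrite <- (Rpower_1 2) at 2 by lra. apply Rpower_lt; lra. }
assert (hid : is_RInt (fun t : R => t) 0 1 (1 / 2)).
{ replace (1 / 2) with (minus (1 ^ 2 / 2) (0 ^ 2 / 2))
    by (unfold minus, plus, opp; simpl; field).
  apply (is_RInt_derive (V := R_CompleteNormedModule) (fun t => t ^ 2 / 2)).
  - intros t _. auto_derive; [exact I | field].
  - intros t _. apply continuous_id. }
assert (hI : is_RInt
  (fun t => U * Rpower ((1 - t) * 1 + t * / 2) s + V / 2 * t) 0 1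
  (U * power_average s 1 (/ 2) + V / 2 * (1 / 2))).
{ apply (is_RInt_plus (V := R_NormedModule));
    apply (is_RInt_scal (V := R_NormedModule)); [|exact hid].
  apply is_RInt_Rpower_affine; lra. }
apply Rle_trans with (U * power_average s 1 (/ 2) + V / 2 * (1 / 2)).
- apply (is_RInt_le _ _ 0 1 _ _ Rle_0_1 hK hI).
  intros t ht.
  replace ((1 - t) * u + t * A u v) with ((1 - t / 2) * u + t / 2 * v)
    by (unfold A; field).
  replace ((1 - t) * 1 + t * / 2) with (1 - t / 2) by field.
  apply Rle_trans with ((1 - t / 2) * U + t / 2 * V).
  + apply Rpower_neg_convex; lra.
  + apply Rplus_le_compat; [|right; field].
    rewrite (Rmult_comm U). apply Rmult_le_compat_r; [lra|].
    apply le_Rpower_of_le_one; lra.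
- replace ((V + (Rpower 2 (s + 1) - 1) * U) / (Rpower 2 s * (s + 1)))
    with (U * power_average s 1 (/ 2) + V * / (Rpower 2 s * (s + 1))).
  + apply Rplus_le_compat_l.
    replace (V / 2 * (1 / 2)) with (V * / 4) by field.
    apply Rmult_le_compat_l; [lra|]. apply Rinv_le_contravar; nra.
  + assert (hone : Rpower 1 (s + 1) = 1).
    { unfold Rpower. rewrite ln_1, Rmult_0_r. apply exp_0. }
    assert (hhalf : Rpower (/ 2) (s + 1) = / (2 * Rpower 2 s)).
    { replace (/ 2) with (1 / 2) by field.
      rewrite Rpower_div, hone, Rpower_plus, Rpower_1 by lra. field. lra. }
    unfold power_average. rewrite hhalf, hone, Rpower_plus, Rpower_1 by lra.
    field. split; lra.
Qed.

(** Hölder's inequality applied to the weight and to x^(-s).  The weight runs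
    from [v] to [u], so its p-norm is exactly [L p u v]; the q-norm of x^(-s) is
    bounded through convexity. *)
Lemma half_average_le (s p q u v : R) :
  0 < s -> s < 1 -> 0 < p -> 0 < q -> 1 / p + 1 / q = 1 ->
  0 < u -> 0 < v -> u <> v ->
  half_average s u v <=
    L p u v *
    Rpower ((Rpower v (- s * q) + (Rpower 2 (s + 1) - 1) * Rpower u (- s * q))
            / (Rpower 2 s * (s + 1))) (1 / q).
Proof.
intros hs0 hs1 hp hq hpq hu hv huv.
set (B := (_ + _) / _).
assert (hm : 0 < A u v) by (unfold A; lra).
assert (hK : ex_RInt (fun t => Rpower ((1 - t) * u + t * A u v) (- (s * q))) 0 1).
{ apply (ex_RInt_continuous (V := R_CompleteNormedModule)). intros t ht.
  rewrite Rmin_left, Rmax_right in ht by lra.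
  apply continuous_Rpower_affine; assumption. }
destruct hK as [K hK].
assert (hKB : K <= B).
{ unfold B. replace (- s * q) with (- (s * q)) by ring.
  apply half_power_average_le; try assumption. nra. }
assert (hB : 0 < B).
{ apply Rdiv_lt_0_compat; [apply endpoint_sum_pos; lra|].
  apply Rmult_lt_0_compat; [apply Rpower_pos | lra]. }
apply (holder p q 0 1 (L p u v) (Rpower B (1 / q)) _ (power_average p v u) K
         (fun t => (1 - t) * v + t * u)
         (fun t => Rpower ((1 - t) * u + t * A u v) (- s))); try assumption.
- lra.
- apply Rpower_pos.
- apply Rpower_pos.
- intros t ht. apply affine_pos; lra.
- intros t ht. apply Rpower_pos.
- apply is_RInt_half_average; assumption.
- apply is_RInt_Rpower_affine; lra.
- apply (is_RInt_ext (V := R_NormedModule)) with (2 := hK).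
  intros t _. rewrite Rpower_mult. f_equal. ring.
- right. rewrite Rpower_L by lra. apply power_average_sym; lra.
- rewrite Rpower_mult. replace (1 / q * q) with 1 by (field; lra).
  rewrite Rpower_1 by exact hB. exact hKB.
Qed.

(** * The inequality *)

(** With f(x) = x^(1-s)/(1-s), integration by parts on each half leaves the
    average of f and boundary terms.  At the midpoint the weight is the near
    endpoint, [a] on one half and [b] on the other, and the two boundary terms
    merge into -(b - a) f(A); at the ends it is the far endpoint, which
    produces -(b f(a) - a f(b)), the term with G^2.  The check below is purely
    algebraic: every power is a multiple of one of exponent -s. *)
Lemma mean_difference_split (s a b : R) :
  0 < a -> a < b -> 0 < s -> s < 1 ->
  Rpower (L (1 - s) a b) (1 - s) / (1 - s)
  - (s * (G a b) ^ 2 * Rpower (L (-1 - s) a b) (-1 - s)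
     + Rpower (A a b) (1 - s)) / (2 * (1 - s))
  = (half_average s a b + half_average s b a) / 4.
Proof.
intros ha hab hs0 hs1.
rewrite !Rpower_L by lra.
assert (hG : (G a b) ^ 2 = a * b) by (unfold G; apply pow2_sqrt; nra).
rewrite hG.
assert (hA : A b a = A a b) by (unfold A; field).
unfold half_average. rewrite hA. unfold power_average.
assert (h1 : forall x, 0 < x -> Rpower x (1 - s + 1) = x ^ 2 * Rpower x (- s)).
{ intros x hx. replace (1 - s + 1) with (1 + 1 + - s) by ring.
  rewrite !Rpower_plus, Rpower_1 by exact hx. ring. }
assert (h2 : forall x, 0 < x -> Rpower x (- s + 1) = x * Rpower x (- s)).
{ intros x hx. rewrite Rpower_plus, Rpower_1 by exact hx. ring. }
assert (hm : 0 < A a b) by (unfold A; lra).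
replace (-1 - s + 1) with (- s) by ring.
rewrite !h1, !h2 by lra.
replace (1 - s) with (- s + 1) by ring.
rewrite h2 by exact hm.
generalize (Rpower (A a b) (- s)), (Rpower a (- s)), (Rpower b (- s)).
intros M X Y. unfold A. field. repeat split; lra.
Qed.

Theorem proposition4 (a b s p q : R)
  (ha : 0 < a) (hab : a < b)
  (hs0 : 0 < s) (hs1 : s < 1)
  (hq : 1 < q) (hpq : 1 / p + 1 / q = 1) :
  Rabs (Rpower (L (1 - s) a b) (1 - s) / (1 - s)
        - (s * (G a b) ^ 2 * Rpower (L (-1 - s) a b) (-1 - s)
           + Rpower (A a b) (1 - s)) / (2 * (1 - s)))
  <= L p a b / Rpower (Rpower 2 (2 * q + s) * (s + 1)) (1 / q)
     * (Rpower (Rpower b (- s * q) + (Rpower 2 (s + 1) - 1) * Rpower a (- s * q))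
               (1 / q)
        + Rpower (Rpower a (- s * q) + (Rpower 2 (s + 1) - 1) * Rpower b (- s * q))
                 (1 / q)).
Proof.
assert (hp : 0 < p).
{ rewrite <- (Rinv_inv p). apply Rinv_0_lt_compat.
  assert (1 / q < 1) by (apply Rlt_div_l; lra).
  unfold Rdiv in *. lra. }
rewrite mean_difference_split by assumption.
assert (hna := half_average_nonneg s a b hs0 hs1 ha ltac:(lra) ltac:(lra)).
assert (hnb := half_average_nonneg s b a hs0 hs1 ltac:(lra) ha ltac:(lra)).
rewrite Rabs_pos_eq by lra.
assert (hla := half_average_le s p q a b hs0 hs1 hp ltac:(lra) hpq ha
                 ltac:(lra) ltac:(lra)).
assert (hlb := half_average_le s p q b a hs0 hs1 hp ltac:(lra) hpq
                 ltac:(lra) ha ltac:(lra)).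
rewrite (L_sym p b a) in hlb by lra.
assert (hD : 0 < Rpower 2 s * (s + 1)).
{ apply Rmult_lt_0_compat; [apply Rpower_pos | lra]. }
assert (split_div : forall x y,
  Rpower ((Rpower x (- s * q) + (Rpower 2 (s + 1) - 1) * Rpower y (- s * q))
          / (Rpower 2 s * (s + 1))) (1 / q)
  = Rpower (Rpower x (- s * q) + (Rpower 2 (s + 1) - 1) * Rpower y (- s * q))
      (1 / q) / Rpower (Rpower 2 s * (s + 1)) (1 / q)).
{ intros x y. apply Rpower_div; [apply endpoint_sum_pos; lra | exact hD]. }
rewrite split_div in hla, hlb.
(* The factor 2^(2q) under the root of order q is the 4 dividing the sum. *)
replace (Rpower (Rpower 2 (2 * q + s) * (s + 1)) (1 / q))
  with (4 * Rpower (Rpower 2 s * (s + 1)) (1 / q)).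
- assert (hR := Rpower_pos (Rpower 2 s * (s + 1)) (1 / q)).
  apply (Rle_trans _ _ _ (Rmult_le_compat_r (/ 4) _ _ ltac:(lra)
                            (Rplus_le_compat _ _ _ _ hla hlb))).
  right. field. lra.
- rewrite Rpower_plus, Rmult_assoc.
  rewrite <- (Rpower_mult_distr (Rpower 2 (2 * q))) by auto using Rpower_pos.
  f_equal. rewrite Rpower_mult. replace (2 * q * (1 / q)) with (1 + 1).
  + rewrite Rpower_plus, Rpower_1 by lra. ring.
  + field. lra.
Qed.
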